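(* Let $\mathcal{B}$ be a bicategory. A horizontal arrow $$\bigl(A_0\xrightarrow{f_1}A_1\xrightarrow{f_2}\cdots\xrightarrow{f_n}A_n;\,i_0,i_1\bigr)$$ in $\mathbf{Dbl}(\mathcal{B})$ (a path of arrows in $\mathcal{B}$ with marked indices $i_0\le i_1$) has a companion if and only if $A_{i_0}=A_{i_1}$ and the chosen composition $\varphi_{f_{i_0+1},\dots,f_{i_1}}$ is a quasi unit in $\mathcal{B}$.
   Context: In a double category, $\circ$ is horizontal composition, $\cdot$ vertical composition ($\beta\cdot\alpha$ has $\alpha$ on top), $\mathrm{Id}_A$ and $1_A$ are horizontal and vertical identity arrows, $\mathrm{id}_v$ the horizontal identity cell on a vertical arrow $v$, $1_f$ the vertical identity cell on a horizontal arrow $f$. A horizontal arrow $f\colon A\to B$ *has a companion* if there are a vertical arrow $v\colon A\to B$ and cells $\psi$ (top $\mathrm{Id}_A$, bottom $f$, left $1_A$, right $v$) and $\chi$ (top $f$, bottom $\mathrm{Id}_B$, left $v$, right $1_B$) with $\chi\circ\psi=1_f$ and $\chi\cdot\psi=\mathrm{id}_v$. The double category $\mathbf{Dbl}(\mathcal{B})$ of marked paths: choose a composite $\varphi_{f_1,\dots,f_n}$ (a bracketed composition) of each finite path of composable arrows of $\mathcal{B}$, the empty path at $A$ having composite $1_A$. Objects: paths $A_0\xrightarrow{f_1}\cdots\xrightarrow{f_n}A_n$ with a marked index $i_0$. There is a unique vertical arrow between two objects iff their marked objects $A_{i_0}$, $B_{j_0}$ are equal, and none otherwise. Horizontal arrows: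 paths with two marked indices $i_0\le i_1$, with domain the path marked at $i_0$ and codomain the path marked at $i_1$; $(i_0,i_1)$ followed by $(i_1,i_2)$ on the same path is $(i_0,i_2)$. A double cell from $(f_1,\dots,f_n;i_0,i_1)$ to $(g_1,\dots,g_m;j_0,j_1)$ exists only if $A_{i_0}=B_{j_0}$ and $A_{i_1}=B_{j_1}$, and is a 2-cell $\varphi_{f_{i_0+1},\dots,f_{i_1}}\Rightarrow\varphi_{g_{j_0+1},\dots,g_{j_1}}$ in $\mathcal{B}$. Vertical composition is that of 2-cells; horizontal composition is horizontal composition of 2-cells in $\mathcal{B}$ conjugated by the canonical associativity/unit coherence isomorphisms between chosen composites. An endomorphism $f\colon A\to A$ in a bicategory is a *quasi unit* if there is an invertible 2-cell $f\cong1_A$. *)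

(* Defs.v *)
From mathcomp Require Import all_boot.
From Stdlib Require Import ProofIrrelevance.

Set Implicit Arguments.
Unset Strict Implicit.
Unset Printing Implicit Defensive.

(* [comp1], [comp2] and [hcomp2] take their arguments in diagrammatic order:
   [comp1 f g] is the composite usually written g o f. *)
Record bicategory := Bicategory {
  ob :> Type;
  hom : ob -> ob -> Type;
  cell2 : forall A B, hom A B -> hom A B -> Type;
  id1 : forall A, hom A A;
  comp1 : forall A B C, hom A B -> hom B C -> hom A C;
  id2 : forall A B (f : hom A B), cell2 f f;
  comp2 : forall A B (f g h : hom A B), cell2 f g -> cell2 g h -> cell2 f h;
  hcomp2 : forall A B C (f f' : hom A B) (g g' : hom B C),
    cell2 f f' -> cell2 g g' -> cell2 (comp1 f g) (comp1 f' g');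
  assoc : forall A B C D (f : hom A B) (g : hom B C) (h : hom C D),
    cell2 (comp1 (comp1 f g) h) (comp1 f (comp1 g h));
  assocV : forall A B C D (f : hom A B) (g : hom B C) (h : hom C D),
    cell2 (comp1 f (comp1 g h)) (comp1 (comp1 f g) h);
  lunit : forall A B (f : hom A B), cell2 (comp1 (id1 A) f) f;
  lunitV : forall A B (f : hom A B), cell2 f (comp1 (id1 A) f);
  runit : forall A B (f : hom A B), cell2 (comp1 f (id1 B)) f;
  runitV : forall A B (f : hom A B), cell2 f (comp1 f (id1 B));
  comp2A : forall A B (f g h k : hom A B)
      (a : cell2 f g) (b : cell2 g h) (c : cell2 h k),
    comp2 (comp2 a b) c = comp2 a (comp2 b c);
  comp2id : forall A B (f g : hom A B) (a : cell2 f g), comp2 a (id2 g) = a;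
  id2comp : forall A B (f g : hom A B) (a : cell2 f g), comp2 (id2 f) a = a;
  hcomp2_id : forall A B C (f : hom A B) (g : hom B C),
    hcomp2 (id2 f) (id2 g) = id2 (comp1 f g);
  interchange : forall A B C (f f' f'' : hom A B) (g g' g'' : hom B C)
      (a : cell2 f f') (a' : cell2 f' f'') (b : cell2 g g') (b' : cell2 g' g''),
    hcomp2 (comp2 a a') (comp2 b b') = comp2 (hcomp2 a b) (hcomp2 a' b');
  assocK : forall A B C D (f : hom A B) (g : hom B C) (h : hom C D),
    comp2 (assoc f g h) (assocV f g h) = id2 _;
  assocVK : forall A B C D (f : hom A B) (g : hom B C) (h : hom C D),
    comp2 (assocV f g h) (assoc f g h) = id2 _;
  lunitK : forall A B (f : hom A B), comp2 (lunit f) (lunitV f) = id2 _;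
  lunitVK : forall A B (f : hom A B), comp2 (lunitV f) (lunit f) = id2 _;
  runitK : forall A B (f : hom A B), comp2 (runit f) (runitV f) = id2 _;
  runitVK : forall A B (f : hom A B), comp2 (runitV f) (runit f) = id2 _;
  assoc_nat : forall A B C D (f f' : hom A B) (g g' : hom B C) (h h' : hom C D)
      (a : cell2 f f') (b : cell2 g g') (c : cell2 h h'),
    comp2 (hcomp2 (hcomp2 a b) c) (assoc f' g' h') =
    comp2 (assoc f g h) (hcomp2 a (hcomp2 b c));
  lunit_nat : forall A B (f f' : hom A B) (a : cell2 f f'),
    comp2 (hcomp2 (id2 (id1 A)) a) (lunit f') = comp2 (lunit f) a;
  runit_nat : forall A B (f f' : hom A B) (a : cell2 f f'),
    comp2 (hcomp2 a (id2 (id1 B))) (runit f') = comp2 (runit f) a;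
  triangle : forall A B C (f : hom A B) (g : hom B C),
    comp2 (assoc f (id1 B) g) (hcomp2 (id2 f) (lunit g)) =
    hcomp2 (runit f) (id2 g);
  pentagon : forall A B C D E
      (f : hom A B) (g : hom B C) (h : hom C D) (k : hom D E),
    comp2 (assoc (comp1 f g) h k) (assoc f g (comp1 h k)) =
    comp2 (hcomp2 (assoc f g h) (id2 k))
      (comp2 (assoc f (comp1 g h) k) (hcomp2 (id2 f) (assoc g h k)))
}.

Arguments id1 {b} A : rename.

Notation "f ** g" := (comp1 f g) (at level 40, left associativity).
Notation "a *** b" := (hcomp2 a b) (at level 40, left associativity).
Notation "a ;; b" := (comp2 a b) (at level 50, left associativity).

Record iso2 (B : bicategory) (X Y : B) (f g : hom X Y) := Iso2 {
  fwd :> cell2 f g;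
  bwd : cell2 g f;
  fwdK : fwd ;; bwd = id2 f;
  bwdK : bwd ;; fwd = id2 g
}.

Definition invertible (B : bicategory) (X Y : B) (f g : hom X Y)
    (a : cell2 f g) : Prop :=
  exists b : cell2 g f, a ;; b = id2 f /\ b ;; a = id2 g.

Definition quasi_unit (B : bicategory) (A : B) (f : hom A A) : Prop :=
  exists a : cell2 f (id1 A), invertible a.

Section Isos.
Variable B : bicategory.
Implicit Types X Y Z W : B.

Definition iso_eq X Y (f g : hom X Y) (e : f = g) : iso2 f g :=
  match e in _ = g return iso2 f g with
  | erefl => Iso2 (comp2id (id2 f)) (comp2id (id2 f))
  end.

Definition iso_sym X Y (f g : hom X Y) (i : iso2 f g) : iso2 g f :=
  Iso2 (bwdK i) (fwdK i).

Lemma iso_comp_subproof X Y (f g h : hom X Y) (i : iso2 f g) (j : iso2 g h) :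
  i ;; j ;; (bwd j ;; bwd i) = id2 f.
Proof. by rewrite comp2A -(comp2A j) fwdK id2comp fwdK. Qed.

Definition iso_comp X Y (f g h : hom X Y) (i : iso2 f g) (j : iso2 g h) :
  iso2 f h :=
  Iso2 (iso_comp_subproof i j) (iso_comp_subproof (iso_sym j) (iso_sym i)).

Lemma iso_hcomp_subproof X Y Z (f f' : hom X Y) (g g' : hom Y Z)
    (i : iso2 f f') (j : iso2 g g') :
  (i *** j) ;; (bwd i *** bwd j) = id2 (f ** g).
Proof. by rewrite -interchange !fwdK hcomp2_id. Qed.

Definition iso_hcomp X Y Z (f f' : hom X Y) (g g' : hom Y Z)
    (i : iso2 f f') (j : iso2 g g') : iso2 (f ** g) (f' ** g') :=
  Iso2 (iso_hcomp_subproof i j) (iso_hcomp_subproof (iso_sym i) (iso_sym j)).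

Definition iso_id X Y (f : hom X Y) : iso2 f f := iso_eq erefl.

Definition iso_assoc X Y Z W (f : hom X Y) (g : hom Y Z) (h : hom Z W) :
  iso2 ((f ** g) ** h) (f ** (g ** h)) := Iso2 (assocK f g h) (assocVK f g h).

Definition iso_lunit X Y (f : hom X Y) : iso2 (id1 X ** f) f :=
  Iso2 (lunitK f) (lunitVK f).

Definition iso_runit X Y (f : hom X Y) : iso2 (f ** id1 Y) f :=
  Iso2 (runitK f) (runitVK f).

Lemma iso_cancell X Y (f g h : hom X Y) (i : iso2 f g) (a b : cell2 g h) :
  i ;; a = i ;; b -> a = b.
Proof. by move=> /(congr1 (fun x => bwd i ;; x)); rewrite -!comp2A bwdK !id2comp. Qed.

Lemma iso_cancelr X Y (f g h : hom X Y) (i : iso2 g h) (a b : cell2 f g) :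
  a ;; i = b ;; i -> a = b.
Proof. by move=> /(congr1 (fun x => x ;; bwd i)); rewrite !comp2A fwdK !comp2id. Qed.

Lemma iso_inv_unique X Y (f g : hom X Y) (i j : iso2 f g) :
  fwd i = fwd j -> bwd i = bwd j.
Proof. by move=> e; apply: (@iso_cancell _ _ _ _ _ i); rewrite fwdK e fwdK. Qed.

Lemma id1_hcomp_inj X Y (f g : hom X Y) (a b : cell2 f g) :
  id2 (id1 X) *** a = id2 (id1 X) *** b -> a = b.
Proof.
by move=> e; apply: (@iso_cancell _ _ _ _ _ (iso_lunit f)); rewrite -!lunit_nat e.
Qed.

Lemma hcomp_id1_inj X Y (f g : hom X Y) (a b : cell2 f g) :
  a *** id2 (id1 Y) = b *** id2 (id1 Y) -> a = b.
Proof.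
by move=> e; apply: (@iso_cancell _ _ _ _ _ (iso_runit f)); rewrite -!runit_nat e.
Qed.

Lemma interl X Y Z (f : hom X Y) (g g' g'' : hom Y Z)
    (b : cell2 g g') (b' : cell2 g' g'') :
  id2 f *** (b ;; b') = (id2 f *** b) ;; (id2 f *** b').
Proof. by rewrite -interchange comp2id. Qed.

Lemma interr X Y Z (f f' f'' : hom X Y) (g : hom Y Z)
    (a : cell2 f f') (a' : cell2 f' f'') :
  (a ;; a') *** id2 g = (a *** id2 g) ;; (a' *** id2 g).
Proof. by rewrite -interchange comp2id. Qed.

Lemma assoc_lunit X Y Z (f : hom X Y) (g : hom Y Z) :
  assoc (id1 X) f g ;; lunit (f ** g) = lunit f *** id2 g.
Proof.
apply: id1_hcomp_inj.
apply: (@iso_cancell _ _ _ _ _ (iso_comp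
  (iso_hcomp (iso_assoc (id1 X) (id1 X) f) (iso_id g))
  (iso_assoc (id1 X) (id1 X ** f) g))).
rewrite /= [RHS]comp2A -assoc_nat -[RHS]comp2A -interr triangle.
rewrite interl -comp2A (comp2A (_ *** _)) -pentagon comp2A triangle.
by rewrite -hcomp2_id -assoc_nat.
Qed.

Lemma assoc_runit X Y Z (f : hom X Y) (g : hom Y Z) :
  assoc f g (id1 Z) ;; (id2 f *** runit g) = runit (f ** g).
Proof.
apply: hcomp_id1_inj.
apply: (@iso_cancelr _ _ _ _ _ (iso_assoc f g (id1 Z))).
rewrite /= interr comp2A assoc_nat -triangle interl -comp2A comp2A -comp2A.
rewrite [X in _ = X ;; _]/= -(triangle (f ** g)) [RHS]comp2A -hcomp2_id assoc_nat.
by rewrite -[RHS]comp2A pentagon !comp2A.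
Qed.

Lemma lunit_runit X : lunit (id1 X) = runit (id1 X).
Proof.
apply: hcomp_id1_inj.
rewrite -assoc_lunit -triangle; congr (_ ;; _).
apply: (@iso_cancelr _ _ _ _ _ (iso_lunit (id1 X))).
by rewrite /= lunit_nat.
Qed.

End Isos.

Inductive apath (B : bicategory) : B -> B -> Type :=
| anil A : apath A A
| acons A C Z (f : hom A C) (p : apath C Z) : apath A Z.

Arguments anil {B} A.

Section Paths.
Variable B : bicategory.

Fixpoint alen (A Z : B) (p : apath A Z) : nat :=
  if p is acons _ _ _ _ q then (alen q).+1 else 0.

(* For [p] = (A_0 -> ... -> A_n), [vertex p i] is A_i; the value for i > n is
   junk (A_n). *)
Fixpoint vertex (A Z : B) (p : apath A Z) (i : nat) : B :=
  match p, i with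
  | anil A, _ => A
  | acons A _ _ _ _, 0 => A
  | acons _ _ _ _ q, i.+1 => vertex q i
  end.

Fixpoint acat (A C Z : B) (p : apath A C) : apath C Z -> apath A Z :=
  match p in apath A C return apath C Z -> apath A Z with
  | anil _ => id
  | acons _ _ _ f q => fun r => acons f (acat q r)
  end.

Fixpoint atake (A Z : B) (p : apath A Z) (j : nat) : apath A (vertex p j) :=
  match p in apath A Z, j return apath A (vertex p j) with
  | anil A, _ => anil A
  | acons A _ _ _ _, 0 => anil A
  | acons _ _ _ f q, j.+1 => acons f (atake q j)
  end.

(* The subpath (f_{i+1}, ..., f_j) of [p] = (f_1, ..., f_n). *)
Fixpoint subpath (A Z : B) (p : apath A Z) (i j : nat) :
    i <= j -> apath (vertex p i) (vertex p j) :=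
  match p in apath A Z, i, j
      return i <= j -> apath (vertex p i) (vertex p j) with
  | anil A, _, _ => fun _ => anil A
  | acons _ _ _ _ _ as p, 0, j => fun _ => atake p j
  | acons _ _ _ _ _, i.+1, 0 => fun le_ij => False_rect _ (notF le_ij)
  | acons _ _ _ _ q, i.+1, j.+1 => fun le_ij => @subpath _ _ q i j le_ij
  end.

(* Bracketings of nonempty paths: binary trees whose leaves are, in order, the
   arrows of the path. *)
Inductive bracketing : forall A Z : B, apath A Z -> Type :=
| br_leaf A C (f : hom A C) : bracketing (acons f (anil C))
| br_node A C Z (p : apath A C) (q : apath C Z) :
    bracketing p -> bracketing q -> bracketing (acat p q).

Fixpoint bcomp (A Z : B) (p : apath A Z) (b : bracketing p) : hom A Z :=
  match b with
  | br_leaf _ _ f => f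
  | br_node _ _ _ _ _ b1 b2 => bcomp b1 ** bcomp b2
  end.

Definition composite_choice : Type :=
  forall (A C Z : B) (f : hom A C) (q : apath C Z), bracketing (acons f q).

Definition chosen (phi : composite_choice) (A Z : B) (p : apath A Z) : hom A Z :=
  match p with
  | anil A => id1 A
  | acons _ _ _ f q => bcomp (phi _ _ _ f q)
  end.

(* Every bracketed composite of a path is compared with the right-bracketed
   composite f_1 (f_2 (... (f_n 1))).  All the 2-cells below are built from
   associativity and unit constraints only, so that, by coherence, they are the
   canonical ones. *)

Fixpoint nform (A Z : B) (p : apath A Z) : hom A Z :=
  match p with
  | anil A => id1 A
  | acons _ _ _ f q => f ** nform q
  end.

Fixpoint nform_cat (A C Z : B) (p : apath A C) :
    forall q : apath C Z, iso2 (nform p ** nform q) (nform (acat p q)) :=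
  match p in apath A C return
    forall q : apath C Z, iso2 (nform p ** nform q) (nform (acat p q)) with
  | anil _ => fun q => iso_lunit (nform q)
  | acons _ _ _ f p' => fun q =>
      iso_comp (iso_assoc f (nform p') (nform q))
               (iso_hcomp (iso_id f) (nform_cat p' q))
  end.

Fixpoint bcomp_nform (A Z : B) (p : apath A Z) (b : bracketing p) :
    iso2 (bcomp b) (nform p) :=
  match b in bracketing p return iso2 (bcomp b) (nform p) with
  | br_leaf _ _ f => iso_sym (iso_runit f)
  | br_node _ _ _ p q b1 b2 =>
      iso_comp (iso_hcomp (bcomp_nform b1) (bcomp_nform b2)) (nform_cat p q)
  end.

Definition chosen_nform (phi : composite_choice) (A Z : B) (p : apath A Z) :
    iso2 (chosen phi p) (nform p) :=
  match p with
  | anil A => iso_id (id1 A)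
  | acons _ _ _ f q => bcomp_nform (phi _ _ _ f q)
  end.

(* The coherence isomorphism between the chosen composite of a concatenation
   and the composite of the chosen composites. *)
Definition chosen_cat (phi : composite_choice) (A C Z : B)
    (p : apath A C) (q : apath C Z) (r : apath A Z) (e : r = acat p q) :
    iso2 (chosen phi p ** chosen phi q) (chosen phi r) :=
  iso_comp (iso_hcomp (chosen_nform phi p) (chosen_nform phi q))
    (iso_comp (nform_cat p q)
      (iso_comp (iso_eq (congr1 (@nform A Z) (esym e)))
                (iso_sym (chosen_nform phi r)))).

End Paths.

Section Coherence.
Variable B : bicategory.

Lemma eq_proofs_irr (T : Type) (x y : T) (e e' : x = y) : e = e'.
Proof. exact: proof_irrelevance. Qed.

Lemma iso_eqVK (A Z : B) (p q : apath A Z) (e : p = q) :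
  iso_eq (congr1 (@nform B A Z) (esym e)) ;; iso_eq (congr1 (@nform B A Z) e) =
  id2 _.
Proof. by case: _ / e => /=; rewrite comp2id. Qed.

Lemma iso_eq_acons (A C Z : B) (f : hom A C) (p q : apath C Z) (e : p = q) :
  fwd (iso_eq (congr1 (@nform B A Z) (congr1 (acons f) e))) =
  id2 f *** iso_eq (congr1 (@nform B C Z) e).
Proof. by case: _ / e; rewrite /= hcomp2_id. Qed.

Lemma nform_cat_assoc (A C D Z : B)
    (p : apath A C) (q : apath C D) (s : apath D Z)
    (e : acat (acat p q) s = acat p (acat q s)) :
  (nform_cat p q *** id2 (nform s)) ;; nform_cat (acat p q) s
    ;; iso_eq (congr1 (@nform B A Z) e) =
  assoc (nform p) (nform q) (nform s) ;; (id2 (nform p) *** nform_cat q s)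
    ;; nform_cat p (acat q s).
Proof.
elim: p q e => [{}C q e|X Y {}C f p IH q e] /=.
  rewrite (eq_proofs_irr e erefl) /= comp2id comp2A lunit_nat -comp2A.
  by rewrite assoc_lunit.
have e' : acat (acat p q) s = acat p (acat q s).
  elim: p {IH e} q => [W q|W1 W2 W3 f' p IH q] //=.
  by congr acons; apply: IH.
rewrite (eq_proofs_irr e (congr1 (acons f) e')) iso_eq_acons.
rewrite interr !comp2A -(comp2A (_ *** _ *** _) (assoc _ _ _)) assoc_nat.
rewrite !comp2A -!interl -(comp2A (nform_cat p q *** _)) IH -hcomp2_id !interl !comp2A.
rewrite -(comp2A (id2 f *** id2 _ *** nform_cat q s)) assoc_nat !comp2A.
by rewrite -(comp2A (assoc _ _ _) (assoc _ _ _)) pentagon !comp2A.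
Qed.

Lemma nform_cat_anil (A Z : B) (p : apath A Z) (e : acat p (anil Z) = p) :
  nform_cat p (anil Z) ;; iso_eq (congr1 (@nform B A Z) e) = runit (nform p).
Proof.
elim: p e => [{}Z e|X Y {}Z f p IH e] /=.
  by rewrite (eq_proofs_irr e erefl) /= comp2id lunit_runit.
have e' : acat p (anil Z) = p.
  elim: p {IH e} => [W|W1 W2 W3 f' p IH] //=.
  by congr acons; apply: IH.
rewrite (eq_proofs_irr e (congr1 (acons f) e')) iso_eq_acons.
by rewrite comp2A -interl IH assoc_runit.
Qed.

Variable phi : composite_choice B.
Let N := chosen_nform phi.
Let E := chosen_cat phi.

Lemma chosen_cat_nform (A C Z : B) (p : apath A C) (q : apath C Z) r
    (e : r = acat p q) :
  E e ;; N r =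
  (N p *** N q) ;; nform_cat p q ;; iso_eq (congr1 (@nform B A Z) (esym e)).
Proof. by rewrite /E /chosen_cat /= !comp2A bwdK comp2id. Qed.

Lemma chosen_catA (A C D Z : B) (p : apath A C) (q : apath C D) (s : apath D Z)
    r1 r2 r (e1 : r1 = acat p q) (e2 : r = acat r1 s)
    (e3 : r2 = acat q s) (e4 : r = acat p r2) :
  (E e1 *** id2 (chosen phi s)) ;; E e2 =
  assoc (chosen phi p) (chosen phi q) (chosen phi s)
    ;; (id2 (chosen phi p) *** E e3) ;; E e4.
Proof.
apply: (@iso_cancelr _ _ _ _ _ _ (N r)).
rewrite !(comp2A _ (E _)) !chosen_cat_nform -!comp2A -interchange.
rewrite (comp2A (assoc _ _ _)) -interchange !chosen_cat_nform.
subst r1 r2 r; rewrite /= !comp2id !id2comp.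
have -> : (N p *** N q ;; nform_cat p q) *** N s =
    (N p *** N q *** N s) ;; (nform_cat p q *** id2 _).
  by rewrite -interchange comp2id.
have -> : N p *** (N q *** N s ;; nform_cat q s) =
    (N p *** (N q *** N s)) ;; (id2 _ *** nform_cat q s).
  by rewrite -interchange comp2id.
apply: (@iso_cancelr _ _ _ _ _ _ (iso_eq (congr1 (@nform B A Z) e4))).
rewrite !comp2A iso_eqVK comp2id -(comp2A (nform_cat p q *** _)).
by rewrite nform_cat_assoc -!comp2A assoc_nat.
Qed.

Lemma chosen_catA_cast (A C D Z : B) (p : apath A C) (q : apath C D)
    (s : apath D Z) r1 r2 r r' (e1 : r1 = acat p q) (e2 : r = acat r1 s)
    (e3 : r2 = acat q s) (e4 : r' = acat p r2) (e : r = r') :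
  (E e1 *** id2 (chosen phi s)) ;; E e2
    ;; iso_eq (congr1 (@chosen B phi A Z) e) =
  assoc (chosen phi p) (chosen phi q) (chosen phi s)
    ;; (id2 (chosen phi p) *** E e3) ;; E e4.
Proof. by case: _ / e e4 => e4; rewrite comp2id; apply: chosen_catA. Qed.

Lemma chosen_cat_anill (A Z : B) (p : apath A A) (q r : apath A Z)
    (e0 : anil A = p) (e : r = acat p q) (e1 : r = q) :
  (iso_eq (congr1 (@chosen B phi A A) e0) *** id2 (chosen phi q)) ;; E e
    ;; iso_eq (congr1 (@chosen B phi A Z) e1) = lunit (chosen phi q).
Proof.
apply: (@iso_cancelr _ _ _ _ _ _ (N q)).
subst p q; rewrite hcomp2_id id2comp comp2id chosen_cat_nform.
by rewrite (eq_proofs_irr e erefl) /= comp2id lunit_nat.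
Qed.

Lemma chosen_cat_anilr (A Z : B) (p r : apath A Z) (q : apath Z Z)
    (e0 : anil Z = q) (e : r = acat p q) (e1 : r = p) :
  (id2 (chosen phi p) *** iso_eq (congr1 (@chosen B phi Z Z) e0)) ;; E e
    ;; iso_eq (congr1 (@chosen B phi A Z) e1) = runit (chosen phi p).
Proof.
apply: (@iso_cancelr _ _ _ _ _ _ (N p)).
subst q p; rewrite hcomp2_id id2comp comp2id chosen_cat_nform.
by rewrite comp2A nform_cat_anil runit_nat.
Qed.

End Coherence.

Definition dcast (O : Type) (H V : O -> O -> Type)
    (cell : forall A B C D, H A B -> H C D -> V A C -> V B D -> Type)
    A B C D (f f' : H A B) (g g' : H C D) (u u' : V A C) (v v' : V B D)
    (ef : f = f') (eg : g = g') (eu : u = u') (ev : v = v')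
    (a : cell A B C D f g u v) : cell A B C D f' g' u' v' :=
  match ef in _ = f', eg in _ = g', eu in _ = u', ev in _ = v'
      return cell A B C D f' g' u' v' with
  | erefl, erefl, erefl, erefl => a
  end.

(* Strict double categories.  A cell in [dcell f g u v] has top [f], bottom
   [g], left side [u] and right side [v].  Compositions are diagrammatic:
   [dhcomp a b] has [a] on the left, [dvcomp a b] has [a] on top.  [dhid u] is
   the horizontal identity cell on a vertical arrow, [dvid f] the vertical
   identity cell on a horizontal arrow. *)
Record double_category := DoubleCategory {
  dob :> Type;
  harrow : dob -> dob -> Type;
  varrow : dob -> dob -> Type;
  dcell : forall A B C D,
    harrow A B -> harrow C D -> varrow A C -> varrow B D -> Type;
  hid : forall A, harrow A A;
  hcomp : forall A B C, harrow A B -> harrow B C -> harrow A C;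
  vid : forall A, varrow A A;
  vcomp : forall A B C, varrow A B -> varrow B C -> varrow A C;
  hidl : forall A B (f : harrow A B), hcomp (hid A) f = f;
  hidr : forall A B (f : harrow A B), hcomp f (hid B) = f;
  hcompA : forall A B C D (f : harrow A B) (g : harrow B C) (h : harrow C D),
    hcomp (hcomp f g) h = hcomp f (hcomp g h);
  vidl : forall A B (u : varrow A B), vcomp (vid A) u = u;
  vidr : forall A B (u : varrow A B), vcomp u (vid B) = u;
  vcompA : forall A B C D (u : varrow A B) (v : varrow B C) (w : varrow C D),
    vcomp (vcomp u v) w = vcomp u (vcomp v w);
  dhid : forall A C (u : varrow A C), dcell (hid A) (hid C) u u;
  dvid : forall A B (f : harrow A B), dcell f f (vid A) (vid B);
  dhcomp : forall A B E C D F (f : harrow A B) (f' : harrow B E)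
      (g : harrow C D) (g' : harrow D F)
      (u : varrow A C) (v : varrow B D) (w : varrow E F),
    dcell f g u v -> dcell f' g' v w -> dcell (hcomp f f') (hcomp g g') u w;
  dvcomp : forall A B C D E F (f : harrow A B) (g : harrow C D) (h : harrow E F)
      (u : varrow A C) (v : varrow B D) (u' : varrow C E) (v' : varrow D F),
    dcell f g u v -> dcell g h u' v' -> dcell f h (vcomp u u') (vcomp v v');
  dhidl : forall A B C D (f : harrow A B) (g : harrow C D)
      (u : varrow A C) (v : varrow B D) (a : dcell f g u v),
    dcast (hidl f) (hidl g) erefl erefl (dhcomp (dhid u) a) = a;
  dhidr : forall A B C D (f : harrow A B) (g : harrow C D)
      (u : varrow A C) (v : varrow B D) (a : dcell f g u v),
    dcast (hidr f) (hidr g) erefl erefl (dhcomp a (dhid v)) = a;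
  dhcompA : forall A1 A2 A3 A4 C1 C2 C3 C4
      (f1 : harrow A1 A2) (f2 : harrow A2 A3) (f3 : harrow A3 A4)
      (g1 : harrow C1 C2) (g2 : harrow C2 C3) (g3 : harrow C3 C4)
      (u1 : varrow A1 C1) (u2 : varrow A2 C2) (u3 : varrow A3 C3)
      (u4 : varrow A4 C4)
      (a : dcell f1 g1 u1 u2) (b : dcell f2 g2 u2 u3) (c : dcell f3 g3 u3 u4),
    dcast (hcompA f1 f2 f3) (hcompA g1 g2 g3) erefl erefl
      (dhcomp (dhcomp a b) c) = dhcomp a (dhcomp b c);
  dvidl : forall A B C D (f : harrow A B) (g : harrow C D)
      (u : varrow A C) (v : varrow B D) (a : dcell f g u v),
    dcast erefl erefl (vidl u) (vidl v) (dvcomp (dvid f) a) = a;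
  dvidr : forall A B C D (f : harrow A B) (g : harrow C D)
      (u : varrow A C) (v : varrow B D) (a : dcell f g u v),
    dcast erefl erefl (vidr u) (vidr v) (dvcomp a (dvid g)) = a;
  dvcompA : forall A1 A2 A3 A4 C1 C2 C3 C4
      (f1 : harrow A1 C1) (f2 : harrow A2 C2) (f3 : harrow A3 C3)
      (f4 : harrow A4 C4)
      (u1 : varrow A1 A2) (u2 : varrow A2 A3) (u3 : varrow A3 A4)
      (v1 : varrow C1 C2) (v2 : varrow C2 C3) (v3 : varrow C3 C4)
      (a : dcell f1 f2 u1 v1) (b : dcell f2 f3 u2 v2) (c : dcell f3 f4 u3 v3),
    dcast erefl erefl (vcompA u1 u2 u3) (vcompA v1 v2 v3)
      (dvcomp (dvcomp a b) c) = dvcomp a (dvcomp b c);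
  dinterchange : forall A1 A2 A3 C1 C2 C3 E1 E2 E3
      (f1 : harrow A1 A2) (f2 : harrow A2 A3)
      (g1 : harrow C1 C2) (g2 : harrow C2 C3)
      (h1 : harrow E1 E2) (h2 : harrow E2 E3)
      (u1 : varrow A1 C1) (u2 : varrow A2 C2) (u3 : varrow A3 C3)
      (v1 : varrow C1 E1) (v2 : varrow C2 E2) (v3 : varrow C3 E3)
      (a : dcell f1 g1 u1 u2) (b : dcell f2 g2 u2 u3)
      (c : dcell g1 h1 v1 v2) (d : dcell g2 h2 v2 v3),
    dvcomp (dhcomp a b) (dhcomp c d) = dhcomp (dvcomp a c) (dvcomp b d);
  dvid_hcomp : forall A B C (f : harrow A B) (g : harrow B C),
    dhcomp (dvid f) (dvid g) = dvid (hcomp f g);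
  dhid_vcomp : forall A B C (u : varrow A B) (v : varrow B C),
    dvcomp (dhid u) (dhid v) = dhid (vcomp u v);
  dvid_hid : forall A, dvid (hid A) = dhid (vid A)
}.

(* The casts only identify f o Id = f, Id o f = f, v . 1 = v and 1 . v = v. *)
Definition has_companion (D : double_category) (A B : D) (f : harrow A B) :
    Prop :=
  exists (v : varrow A B) (psi : dcell (hid A) f (vid A) v)
         (chi : dcell f (hid B) v (vid B)),
    dcast (hidl f) (hidr f) erefl erefl (dhcomp psi chi) = dvid f /\
    dcast erefl erefl (vidl v) (vidr v) (dvcomp psi chi) = dhid v.

Section Transported.
Variable B : bicategory.
Implicit Types X Y Z W : B.

Definition hom_cast X Y Z W (u : X = Z) (v : Y = W) (f : hom X Y) : hom Z W :=
  match u in _ = Z, v in _ = W return hom Z W with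
  | erefl, erefl => f
  end.

(* 2-cells from [f] to [g] when the endpoints of [f] and [g] are equal. *)
Definition tcell X Y Z W (f : hom X Y) (g : hom Z W) (u : X = Z) (v : Y = W) :
    Type :=
  cell2 (hom_cast u v f) g.

Definition tcell_id X Z (u : X = Z) : tcell (id1 X) (id1 Z) u u :=
  match u as u in _ = Z return tcell (id1 X) (id1 Z) u u with
  | erefl => id2 (id1 X)
  end.

Definition tcell_comp X1 X2 X3 Y1 Y2 Y3
    (f : hom X1 Y1) (g : hom X2 Y2) (h : hom X3 Y3)
    (u : X1 = X2) (v : Y1 = Y2) (u' : X2 = X3) (v' : Y2 = Y3)
    (a : tcell f g u v) :
    tcell g h u' v' -> tcell f h (etrans u u') (etrans v v') :=
  match u' as u' in _ = X3, v' as v' in _ = Y3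
      return forall h : hom X3 Y3,
        tcell g h u' v' -> tcell f h (etrans u u') (etrans v v') with
  | erefl, erefl => fun h b => a ;; b
  end h.

Definition tcell_hcomp X Y Z X' Y' Z' (f : hom X Y) (g : hom Y Z)
    (f' : hom X' Y') (g' : hom Y' Z') (u : X = X') (v : Y = Y') (w : Z = Z') :
    tcell f f' u v -> tcell g g' v w -> tcell (f ** g) (f' ** g') u w :=
  match u as u in _ = X', v as v in _ = Y', w as w in _ = Z'
      return forall (f' : hom X' Y') (g' : hom Y' Z'),
        tcell f f' u v -> tcell g g' v w -> tcell (f ** g) (f' ** g') u w with
  | erefl, erefl, erefl => fun f' g' a b => a *** b
  end f' g'.

Definition tcell_conj X Y Z W (f f0 : hom X Y) (g g0 : hom Z W)
    (u : X = Z) (v : Y = W) (i : iso2 f f0) (j : iso2 g g0) :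
    tcell f g u v -> tcell f0 g0 u v :=
  match u as u in _ = Z, v as v in _ = W
      return forall g g0 : hom Z W,
        iso2 g g0 -> tcell f g u v -> tcell f0 g0 u v with
  | erefl, erefl => fun g g0 j a => bwd i ;; a ;; j
  end g g0 j.

Definition tcell_cast X Y Z W (f : hom X Y) (g : hom Z W)
    (u u' : X = Z) (v v' : Y = W) (eu : u = u') (ev : v = v') :
    tcell f g u v -> tcell f g u' v' :=
  match eu in _ = u', ev in _ = v' return tcell f g u v -> tcell f g u' v' with
  | erefl, erefl => id
  end.

Lemma tcell_conj_id X Y Z W (f : hom X Y) (g : hom Z W) (u : X = Z) (v : Y = W)
    (a : tcell f g u v) :
  tcell_conj (iso_id f) (iso_id g) a = a.
Proof. by subst Z W; rewrite /= comp2id id2comp. Qed.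

Lemma tcell_conj_id2 X Y (f f0 : hom X Y) (i : iso2 f f0) :
  tcell_conj i i (id2 f : tcell f f erefl erefl) = id2 f0.
Proof. by rewrite /= comp2id bwdK. Qed.

Lemma tcell_hidl X Y Z W (f k : hom X Y) (f' k' : hom Z W) h h'
    (i0 : iso2 (id1 X) h) (i : iso2 (h ** f) k) (i1 : iso2 k f)
    (i0' : iso2 (id1 Z) h') (i' : iso2 (h' ** f') k') (i1' : iso2 k' f')
    (u : X = Z) (v : Y = W) (a : tcell f f' u v) :
  (i0 *** id2 f) ;; i ;; i1 = lunit f ->
  (i0' *** id2 f') ;; i' ;; i1' = lunit f' ->
  tcell_conj i1 i1'
    (tcell_conj i i' (tcell_hcomp (tcell_conj i0 i0' (tcell_id u)) a)) = a.
Proof.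
move=> L L'; subst Z W.
have LV := @iso_inv_unique _ _ _ _ _
  (iso_comp (iso_comp (iso_hcomp i0 (iso_id f)) i) i1) (iso_lunit f) L.
rewrite /= comp2id; rewrite /= /tcell /= in a LV *.
have -> : (bwd i0 ;; i0') *** a = (bwd i0 *** id2 f) ;; (i0' *** a).
  by rewrite -interchange id2comp.
rewrite -!comp2A (comp2A (bwd i1)) LV.
have -> : i0' *** a = (id2 _ *** a) ;; (i0' *** id2 f').
  by rewrite -interchange id2comp comp2id.
rewrite -!comp2A (comp2A _ (i0' *** _)) (comp2A _ _ (fwd i1')) L'.
by rewrite comp2A lunit_nat -comp2A lunitVK id2comp.
Qed.

Lemma tcell_hidr X Y Z W (f k : hom X Y) (f' k' : hom Z W) h h'
    (i0 : iso2 (id1 Y) h) (i : iso2 (f ** h) k) (i1 : iso2 k f)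
    (i0' : iso2 (id1 W) h') (i' : iso2 (f' ** h') k') (i1' : iso2 k' f')
    (u : X = Z) (v : Y = W) (a : tcell f f' u v) :
  (id2 f *** i0) ;; i ;; i1 = runit f ->
  (id2 f' *** i0') ;; i' ;; i1' = runit f' ->
  tcell_conj i1 i1'
    (tcell_conj i i' (tcell_hcomp a (tcell_conj i0 i0' (tcell_id v)))) = a.
Proof.
move=> L L'; subst Z W.
have LV := @iso_inv_unique _ _ _ _ _
  (iso_comp (iso_comp (iso_hcomp (iso_id f) i0) i) i1) (iso_runit f) L.
rewrite /= comp2id; rewrite /= /tcell /= in a LV *.
have -> : a *** (bwd i0 ;; i0') = (id2 f *** bwd i0) ;; (a *** i0').
  by rewrite -interchange id2comp.
rewrite -!comp2A (comp2A (bwd i1)) LV.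
have -> : a *** i0' = (a *** id2 _) ;; (id2 f' *** i0').
  by rewrite -interchange id2comp comp2id.
rewrite -!comp2A (comp2A _ (id2 f' *** _)) (comp2A _ _ (fwd i1')) L'.
by rewrite comp2A runit_nat -comp2A runitVK id2comp.
Qed.

Lemma tcell_hcompA X1 X2 X3 X4 Y1 Y2 Y3 Y4
    (f1 : hom X1 X2) (f2 : hom X2 X3) (f3 : hom X3 X4) f12 f23 f f'
    (g1 : hom Y1 Y2) (g2 : hom Y2 Y3) (g3 : hom Y3 Y4) g12 g23 g g'
    (i1 : iso2 (f1 ** f2) f12) (i2 : iso2 (f12 ** f3) f)
    (i3 : iso2 (f2 ** f3) f23) (i4 : iso2 (f1 ** f23) f') (i : iso2 f f')
    (j1 : iso2 (g1 ** g2) g12) (j2 : iso2 (g12 ** g3) g)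
    (j3 : iso2 (g2 ** g3) g23) (j4 : iso2 (g1 ** g23) g') (j : iso2 g g')
    (u1 : X1 = Y1) (u2 : X2 = Y2) (u3 : X3 = Y3) (u4 : X4 = Y4)
    (a : tcell f1 g1 u1 u2) (b : tcell f2 g2 u2 u3) (c : tcell f3 g3 u3 u4) :
  (i1 *** id2 f3) ;; i2 ;; i = assoc f1 f2 f3 ;; (id2 f1 *** i3) ;; i4 ->
  (j1 *** id2 g3) ;; j2 ;; j = assoc g1 g2 g3 ;; (id2 g1 *** j3) ;; j4 ->
  tcell_conj i j
    (tcell_conj i2 j2 (tcell_hcomp (tcell_conj i1 j1 (tcell_hcomp a b)) c)) =
  tcell_conj i4 j4 (tcell_hcomp a (tcell_conj i3 j3 (tcell_hcomp b c))).
Proof.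
move=> L L'; subst Y1 Y2 Y3 Y4.
have LV := @iso_inv_unique _ _ _ _ _
  (iso_comp (iso_comp (iso_hcomp i1 (iso_id f3)) i2) i)
  (iso_comp (iso_comp (iso_assoc f1 f2 f3) (iso_hcomp (iso_id f1) i3)) i4) L.
rewrite /= /tcell /= in a b c LV *.
have -> : (bwd i1 ;; (a *** b) ;; j1) *** c =
    (bwd i1 *** id2 f3) ;; ((a *** b) *** c) ;; (j1 *** id2 g3).
  by rewrite -!interchange id2comp comp2id.
have -> : a *** (bwd i3 ;; (b *** c) ;; j3) =
    (id2 f1 *** bwd i3) ;; (a *** (b *** c)) ;; (id2 g1 *** j3).
  by rewrite -!interchange id2comp comp2id.
rewrite -!comp2A (comp2A (bwd i)) LV.
rewrite (comp2A _ (j1 *** _)) (comp2A _ _ (fwd j)) L' -!comp2A.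
congr (_ ;; _ ;; _).
by rewrite (comp2A _ _ (assoc _ _ _)) assoc_nat !comp2A -(comp2A (assocV _ _ _))
  assocVK id2comp.
Qed.

Lemma tcell_compA X1 X2 X3 X4 Y1 Y2 Y3 Y4
    (f1 : hom X1 Y1) (f2 : hom X2 Y2) (f3 : hom X3 Y3) (f4 : hom X4 Y4)
    (u1 : X1 = X2) (u2 : X2 = X3) (u3 : X3 = X4)
    (v1 : Y1 = Y2) (v2 : Y2 = Y3) (v3 : Y3 = Y4)
    (eu : etrans (etrans u1 u2) u3 = etrans u1 (etrans u2 u3))
    (ev : etrans (etrans v1 v2) v3 = etrans v1 (etrans v2 v3))
    (a : tcell f1 f2 u1 v1) (b : tcell f2 f3 u2 v2) (c : tcell f3 f4 u3 v3) :
  tcell_cast eu ev (tcell_comp (tcell_comp a b) c) =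
  tcell_comp a (tcell_comp b c).
Proof.
subst X4 X3 X2 Y4 Y3 Y2.
rewrite (proof_irrelevance _ eu erefl) (proof_irrelevance _ ev erefl) /=.
exact: comp2A.
Qed.

Lemma tcell_compid X Y Z W (f : hom X Y) (g : hom Z W) (u : X = Z) (v : Y = W)
    (eu : etrans u erefl = u) (ev : etrans v erefl = v) (a : tcell f g u v) :
  tcell_cast eu ev (tcell_comp a (id2 g : tcell g g erefl erefl)) = a.
Proof.
subst Z W.
rewrite (proof_irrelevance _ eu erefl) (proof_irrelevance _ ev erefl) /=.
exact: comp2id.
Qed.

Lemma tcell_idcomp X Y Z W (f : hom X Y) (g : hom Z W) (u : X = Z) (v : Y = W)
    (eu : etrans erefl u = u) (ev : etrans erefl v = v) (a : tcell f g u v) :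
  tcell_cast eu ev (tcell_comp (id2 f : tcell f f erefl erefl) a) = a.
Proof.
subst Z W.
rewrite (proof_irrelevance _ eu erefl) (proof_irrelevance _ ev erefl) /=.
exact: id2comp.
Qed.

Lemma tcell_interchange X1 X2 X3 Y1 Y2 Y3 Z1 Z2 Z3
    (f1 : hom X1 X2) (f2 : hom X2 X3) (g1 : hom Y1 Y2) (g2 : hom Y2 Y3)
    (h1 : hom Z1 Z2) (h2 : hom Z2 Z3) f g h
    (i : iso2 (f1 ** f2) f) (j : iso2 (g1 ** g2) g) (k : iso2 (h1 ** h2) h)
    (u1 : X1 = Y1) (u2 : X2 = Y2) (u3 : X3 = Y3)
    (v1 : Y1 = Z1) (v2 : Y2 = Z2) (v3 : Y3 = Z3)
    (a : tcell f1 g1 u1 u2) (b : tcell f2 g2 u2 u3)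
    (c : tcell g1 h1 v1 v2) (d : tcell g2 h2 v2 v3) :
  tcell_comp (tcell_conj i j (tcell_hcomp a b))
    (tcell_conj j k (tcell_hcomp c d)) =
  tcell_conj i k (tcell_hcomp (tcell_comp a c) (tcell_comp b d)).
Proof.
subst Z1 Z2 Z3 Y1 Y2 Y3; rewrite /= /tcell /= in a b c d *.
by rewrite interchange !comp2A -(comp2A j) fwdK id2comp.
Qed.

Lemma tcell_id_comp X Y Z f g h
    (i : iso2 (id1 X) f) (j : iso2 (id1 Y) g) (k : iso2 (id1 Z) h)
    (u : X = Y) (v : Y = Z) :
  tcell_comp (tcell_conj i j (tcell_id u)) (tcell_conj j k (tcell_id v)) =
  tcell_conj i k (tcell_id (etrans u v)).
Proof.
by subst Z Y; rewrite /= !comp2id comp2A -(comp2A j) fwdK id2comp.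
Qed.

End Transported.

Record marked_path (B : bicategory) := MarkedPath {
  msrc : B;
  mtgt : B;
  mpath : apath msrc mtgt;
  mindex : 'I_(alen mpath).+1
}.

Section Dbl.
Variables (B : bicategory) (phi : composite_choice B).

Definition marked_ob (X : marked_path B) : B := vertex (mpath X) (mindex X).

(* A horizontal arrow out of (p; i) is a further index j >= i on the same path
   p, and its codomain is then (p; j). *)
Inductive marked_arrow (X : marked_path B) : marked_path B -> Type :=
| MarkedArrow (j : 'I_(alen (mpath X)).+1) :
    mindex X <= j -> marked_arrow X (MarkedPath j).

Definition marked_hid (X : marked_path B) : marked_arrow X X :=
  let: MarkedPath _ _ _ i := X in
  @MarkedArrow (MarkedPath i) i (leqnn i).

Definition marked_hcomp (X Y Z : marked_path B)
    (h : marked_arrow X Y) : marked_arrow Y Z -> marked_arrow X Z :=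
  match h in marked_arrow _ Y return marked_arrow Y Z -> marked_arrow X Z with
  | MarkedArrow j le_ij => fun k =>
    match k in marked_arrow _ Z return marked_arrow X Z with
    | MarkedArrow _ le_jk => MarkedArrow (leq_trans le_ij le_jk)
    end
  end.

Definition segment (X Y : marked_path B) (h : marked_arrow X Y) :
    apath (marked_ob X) (marked_ob Y) :=
  match h in marked_arrow _ Y return apath (marked_ob X) (marked_ob Y) with
  | MarkedArrow _ le_ij => subpath (mpath X) le_ij
  end.

Lemma atake_subpath (A Z : B) (p : apath A Z) i j (le_ij : i <= j) :
  atake p j = acat (atake p i) (subpath p le_ij).
Proof.
elim: p i j le_ij => [C|C D E f p IH] [|i] [|j] le_ij //=.
by congr acons; apply: IH.
Qed.

Lemma subpath_refl (A Z : B) (p : apath A Z) i (le_ii : i <= i) :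
  subpath p le_ii = anil (vertex p i).
Proof. by elim: p i le_ii => [C|C D E f p IH] [|i] le_ii //=. Qed.

Lemma subpath_cat (A Z : B) (p : apath A Z) i j k
    (le_ij : i <= j) (le_jk : j <= k) (le_ik : i <= k) :
  subpath p le_ik = acat (subpath p le_ij) (subpath p le_jk).
Proof.
elim: p i j k le_ij le_jk le_ik => [C|C D E f p IH] [|i] [|j] [|k] //= *.
by congr acons; apply: atake_subpath.
Qed.

Lemma segment_hid X : segment (marked_hid X) = anil (marked_ob X).
Proof. by case: X => *; apply: subpath_refl. Qed.

Lemma segment_hcomp X Y Z (h : marked_arrow X Y) (k : marked_arrow Y Z) :
  segment (marked_hcomp h k) = acat (segment h) (segment k).
Proof. by case: h k => j le_ij [k le_jk]; apply: subpath_cat. Qed.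

Lemma marked_hidl X Y (h : marked_arrow X Y) :
  marked_hcomp (marked_hid X) h = h.
Proof.
by case: h => j; case: X j => S T p i /= j le_ij;
  congr MarkedArrow; apply: bool_irrelevance.
Qed.

Lemma marked_hidr X Y (h : marked_arrow X Y) :
  marked_hcomp h (marked_hid Y) = h.
Proof. by case: h => j le_ij /=; congr MarkedArrow; apply: bool_irrelevance. Qed.

Lemma marked_hcompA X Y Z W (h : marked_arrow X Y) (k : marked_arrow Y Z)
    (l : marked_arrow Z W) :
  marked_hcomp (marked_hcomp h k) l = marked_hcomp h (marked_hcomp k l).
Proof.
case: h k l => j le_ij [k le_jk] [l le_kl] /=.
by congr MarkedArrow; apply: bool_irrelevance.
Qed.

Definition marked_cell (X Y Z W : marked_path B)
    (f : marked_arrow X Y) (g : marked_arrow Z W)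
    (u : marked_ob X = marked_ob Z) (v : marked_ob Y = marked_ob W) : Type :=
  tcell (chosen phi (segment f)) (chosen phi (segment g)) u v.

Definition chosen_hid (X : marked_path B) :
    iso2 (id1 (marked_ob X)) (chosen phi (segment (marked_hid X))) :=
  iso_eq (congr1 (chosen phi (Z := _)) (esym (segment_hid X))).

Definition marked_dhid (X Z : marked_path B) (u : marked_ob X = marked_ob Z) :
    marked_cell (marked_hid X) (marked_hid Z) u u :=
  tcell_conj (chosen_hid X) (chosen_hid Z) (tcell_id u).

Definition marked_dvid (X Y : marked_path B) (f : marked_arrow X Y) :
    marked_cell f f erefl erefl :=
  id2 (chosen phi (segment f)).

Definition marked_dvcomp X1 Y1 X2 Y2 X3 Y3 (f : marked_arrow X1 Y1)
    (g : marked_arrow X2 Y2) (h : marked_arrow X3 Y3)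
    (u : marked_ob X1 = marked_ob X2) (v : marked_ob Y1 = marked_ob Y2)
    (u' : marked_ob X2 = marked_ob X3) (v' : marked_ob Y2 = marked_ob Y3)
    (a : marked_cell f g u v) (b : marked_cell g h u' v') :
    marked_cell f h (etrans u u') (etrans v v') :=
  tcell_comp a b.

Definition marked_dhcomp X Y Z X' Y' Z'
    (f : marked_arrow X Y) (f' : marked_arrow Y Z)
    (g : marked_arrow X' Y') (g' : marked_arrow Y' Z')
    (u : marked_ob X = marked_ob X') (v : marked_ob Y = marked_ob Y')
    (w : marked_ob Z = marked_ob Z')
    (a : marked_cell f g u v) (b : marked_cell f' g' v w) :
    marked_cell (marked_hcomp f f') (marked_hcomp g g') u w :=
  tcell_conj (chosen_cat phi (segment_hcomp f f'))
             (chosen_cat phi (segment_hcomp g g')) (tcell_hcomp a b).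

Lemma marked_hcast (X Y Z W : marked_path B) (f f' : marked_arrow X Y)
    (g g' : marked_arrow Z W) (u : marked_ob X = marked_ob Z)
    (v : marked_ob Y = marked_ob W) (ef : f = f') (eg : g = g')
    (a : marked_cell f g u v) :
  dcast ef eg erefl erefl a =
  tcell_conj
    (iso_eq (congr1 (chosen phi (Z := _)) (congr1 (@segment X Y) ef)))
    (iso_eq (congr1 (chosen phi (Z := _)) (congr1 (@segment Z W) eg))) a.
Proof. by subst f' g'; rewrite /= tcell_conj_id. Qed.

Lemma marked_vcast (X Y Z W : marked_path B) (f : marked_arrow X Y)
    (g : marked_arrow Z W) (u u' : marked_ob X = marked_ob Z)
    (v v' : marked_ob Y = marked_ob W) (eu : u = u') (ev : v = v')
    (a : marked_cell f g u v) :
  dcast erefl erefl eu ev a = tcell_cast eu ev a.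
Proof. by case: _ / eu; case: _ / ev. Qed.

Lemma etrans_refl (T : Type) (x y : T) (e : x = y) : etrans erefl e = e.
Proof. by case: _ / e. Qed.

Lemma etransA (T : Type) (x y z t : T) (e1 : x = y) (e2 : y = z) (e3 : z = t) :
  etrans (etrans e1 e2) e3 = etrans e1 (etrans e2 e3).
Proof. by case: _ / e3. Qed.

(* There is a vertical arrow between two marked paths exactly when the marked
   objects are equal; it is unique by proof irrelevance. *)
Definition marked_varrow (X Z : marked_path B) : Prop :=
  marked_ob X = marked_ob Z.

Definition Dbl : double_category.
Proof.
refine (@DoubleCategory (marked_path B) marked_arrow marked_varrow marked_cell
  marked_hid marked_hcomp (fun=> erefl) (fun X Y Z => @etrans _ _ _ _)
  marked_hidl marked_hidr marked_hcompA
  (fun X Y => @etrans_refl _ _ _) (fun _ _ _ => erefl)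
  (fun _ _ _ _ => @etransA _ _ _ _ _)
  marked_dhid marked_dvid (@marked_dhcomp) (@marked_dvcomp)
  _ _ _ _ _ _ _ _ _ _).
- abstract (by move=> *; rewrite marked_hcast; apply: tcell_hidl;
    apply: chosen_cat_anill).
- abstract (by move=> *; rewrite marked_hcast; apply: tcell_hidr;
    apply: chosen_cat_anilr).
- abstract (by move=> *; rewrite marked_hcast; apply: tcell_hcompA;
    apply: chosen_catA_cast).
- abstract (by move=> *; rewrite marked_vcast; apply: tcell_idcomp).
- abstract (by move=> *; rewrite marked_vcast; apply: tcell_compid).
- abstract (by move=> *; rewrite marked_vcast; apply: tcell_compA).
- abstract (by move=> *; apply: tcell_interchange).
- abstract (move=> X Y Z f g; rewrite /marked_dhcomp /marked_dvid;
    by rewrite -(tcell_conj_id2 (chosen_cat phi (segment_hcomp f g))) -hcomp2_id).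
- abstract (by move=> *; apply: tcell_id_comp).
- abstract (by move=> X; apply/esym/(tcell_conj_id2 (chosen_hid X))).
Defined.

Definition marked_harrow (A Z : B) (p : apath A Z) (i0 i1 : 'I_(alen p).+1)
    (le_i : i0 <= i1) : @harrow Dbl (MarkedPath i0) (MarkedPath i1) :=
  @MarkedArrow (MarkedPath i0) i1 le_i.

End Dbl.

(* Main.v *)
(** Once the marked objects are identified, the cells [psi] and [chi] of a
    companion are, up to the coherence isomorphism identifying the chosen
    composite of an empty segment with [id1], 2-cells [p : 1 => f] and
    [q : f => 1], where [f] is the chosen composite.  The vertical identity says
    [p ;; q = 1].  The horizontal one says [q ;; p = 1], because [p *** q]
    conjugated by the unit constraints is [q ;; p], as the left and right
    constraints of an identity arrow agree.  So a companion amounts to an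
    invertible 2-cell between [f] and [id1]. *)

Require Import Defs.
From mathcomp Require Import all_boot.
From Stdlib Require Import ProofIrrelevance.

Lemma unit_conj_hcomp2 (B : bicategory) (X : B) (f : hom X X)
    (p : cell2 (id1 X) f) (q : cell2 f (id1 X)) :
  lunitV f ;; (p *** q) ;; runit f = q ;; p.
Proof.
(* Applying [q] first makes the middle arrow [id1 X ** id1 X], where [lunit] and [runit]
   coincide. *)
have -> : p *** q = (id2 (id1 X) *** q) ;; (p *** id2 (id1 X)).
  by rewrite -Defs.interchange id2comp comp2id.
rewrite !comp2A runit_nat -lunit_runit -(comp2A (_ *** q)) lunit_nat.
by rewrite -!comp2A lunitVK id2comp.
Qed.

(** Arbitrary objects and isomorphisms let an equality [X = Y] be eliminated; in [Dbl] its two sides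
    are vertices of one path. *)
Lemma tcell_companion (B : bicategory) (X Y : B) (f k k' : hom X Y)
    (h : hom X X) (h' : hom Y Y)
    (i0 : iso2 (id1 X) h) (i : iso2 (h ** f) k) (i1 : iso2 k f)
    (j0 : iso2 (id1 Y) h') (j : iso2 (f ** h') k') (j1 : iso2 k' f)
    (eu : forall v : X = Y, etrans erefl v = v)
    (ev : forall v : X = Y, etrans v erefl = v) :
  (i0 *** id2 f) ;; i ;; i1 = lunit f ->
  (id2 f *** j0) ;; j ;; j1 = runit f ->
  (exists (v : X = Y) (psi : tcell h f erefl v) (chi : tcell f h' v erefl),
     tcell_conj i1 j1 (tcell_conj i j (tcell_hcomp psi chi)) = id2 f /\
     tcell_cast (eu v) (ev v) (tcell_comp psi chi) =
       tcell_conj i0 j0 (tcell_id v)) <->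
  exists e : X = Y, quasi_unit (hom_cast erefl (esym e) f).
Proof.
move=> L R.
have LV := @iso_inv_unique _ _ _ _ _
  (iso_comp (iso_comp (iso_hcomp i0 (iso_id f)) i) i1) (iso_lunit f) L.
rewrite /= in LV.
(* The [match] is needed because [chi] and [psi] compose in this order only once [Y] is identified
   with [X]. *)
have horizontal (v : X = Y) (psi : tcell h f erefl v)
    (chi : tcell f h' v erefl) :
    tcell_conj i1 j1 (tcell_conj i j (tcell_hcomp psi chi)) =
    match v as v in _ = Y return forall (f : hom X Y) (h' : hom Y Y),
      iso2 (id1 Y) h' -> tcell h f erefl v -> tcell f h' v erefl ->
      cell2 f f with
    | erefl => fun f h' j0 psi chi => chi ;; bwd j0 ;; (i0 ;; psi)
    end f h' j0 psi chi.
  subst Y; rewrite /tcell /= in psi chi LV *.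
  rewrite -unit_conj_hcomp2 -LV -R.
  have -> : (i0 ;; psi) *** (chi ;; bwd j0) =
      (i0 *** id2 f) ;; (psi *** chi) ;; (id2 f *** bwd j0).
    by rewrite -!Defs.interchange id2comp comp2id.
  rewrite !comp2A -(comp2A (id2 f *** bwd j0)) -Defs.interchange comp2id bwdK.
  rewrite hcomp2_id id2comp -(comp2A (bwd i0 *** _)) -Defs.interchange comp2id bwdK.
  by rewrite hcomp2_id id2comp.
split=> [[v [psi [chi [H V]]]]|[e [q [p [qp pq]]]]].
- rewrite horizontal in H; exists v; subst Y.
  rewrite (proof_irrelevance _ (eu _) erefl) in V.
  rewrite (proof_irrelevance _ (ev _) erefl) /= comp2id in V.
  exists (chi ;; bwd j0), (i0 ;; psi); split=> //.
  by rewrite comp2A -(comp2A psi) [psi ;; chi]V !comp2A fwdK comp2id fwdK.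
- subst Y; exists erefl, (bwd i0 ;; p), (q ;; j0); split.
    by rewrite horizontal -(comp2A i0) fwdK id2comp (comp2A q) fwdK comp2id.
  rewrite (proof_irrelevance _ (eu _) erefl) (proof_irrelevance _ (ev _) erefl).
  by rewrite /= comp2id comp2A -(comp2A p) pq id2comp.
Qed.

Theorem proposition3p6 (B : bicategory) (phi : composite_choice B)
    (A0 An : B) (p : apath A0 An) (i0 i1 : 'I_(alen p).+1) (le_i : i0 <= i1) :
  has_companion (marked_harrow phi le_i) <->
  exists e : vertex p i0 = vertex p i1,
    quasi_unit (hom_cast erefl (esym e) (chosen phi (subpath p le_i))).
Proof.
pose X := MarkedPath i0; pose Y := MarkedPath i1.
pose f : marked_arrow X Y := @MarkedArrow B X i1 le_i.
apply: (iff_trans _ (@tcell_companion _ _ _ _ _ _ _ _ (chosen_hid phi X)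
  (chosen_cat phi (segment_hcomp (marked_hid X) f))
  (iso_eq (congr1 (@chosen _ phi _ _) (congr1 (@segment _ X Y) (marked_hidl f))))
  (chosen_hid phi Y)
  (chosen_cat phi (segment_hcomp f (marked_hid Y)))
  (iso_eq (congr1 (@chosen _ phi _ _) (congr1 (@segment _ X Y) (marked_hidr f))))
  (@etrans_refl _ _ _) (fun _ => erefl)
  (chosen_cat_anill _ _ _ _) (chosen_cat_anilr _ _ _ _))).
(* What remains is to trade each [dcast] for a conjugation by [iso_eq] or a [tcell_cast]. *)
split=> -[v [psi [chi [H V]]]]; exists v, psi, chi; split.
- by rewrite -[LHS]marked_hcast.
- by rewrite -[LHS]marked_vcast.
- by apply: etrans (marked_hcast _ _ _) _.
- by apply: etrans (marked_vcast _ _ _) _.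
Qed.
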